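(* Let $0<c<1$ be real, let $G'$ be a $c$-maximal triangle-free graph, and let $G$ be a triangle-free $\frac{c^2}{2(1+c)}$-disturbed subgraph of $G'$. If $G'$ has a $c$-uniform sparse half, then $G$ has a sparse half.
   Context: All graphs have $n$ vertices. A graph $G'$ of order $n$ is $c$-maximal triangle-free if it is triangle-free and adding any new edge creates at least $cn$ triangles. For a graph $G$ and $F\subseteq E(G)$, $D\subseteq V(G)$ is an $\varepsilon$-covering set for $F$ if $|D|\le\varepsilon|V(G)|$ and every edge of $F$ has an end in $D$. $G$ is an $\varepsilon$-disturbed subgraph of $G'$ if $V(G)=V(G')$, there is an $\varepsilon$-covering set (in $G$) for $E(G)\setminus E(G')$, and $|N_G(v)\setminus N_{G'}(v)|\le\varepsilon|V(G')|$ for every vertex $v$. For a weighted graph $(G,\omega)$ ($\omega:V(G)\to(0,1)$, weights summing to 1, $\omega(uv)=\omega(u)\omega(v)$), a half is $s:V(G)\to\mathbb{R}_{\ge0}$ with $s(v)\le\omega(v)$ and $\sum_v s(v)=1/2$, with $s(uv)=s(u)s(v)$ and $s(E)=\sum_{e\in E}s(e)$; it is a sparse half if $s(E(G))\le1/50$. A $c$-uniform sparse half of $(G,\omega)$ is a probability distribution $\mathbf s$ on the set of halves with $\mathbb E[\mathbf s(e)]\ge c\,\omega(e)$ for every $e\in E(G)$ and $\mathbb E[\mathbf s(E(G))]\le 1/50$. For an unweighted graph, halves and ($c$-uniform) sparse halves refer to the uniformly weighted graph ($\omega(v)=1/n$); an unweighted graph $G$ ''has a sparse half'' meaning it contains a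 set of $\lfloor n/2\rfloor$ vertices spanning at most $n^2/50$ edges. *)

(* Defs.v *)
From HB Require Import structures.
From mathcomp Require Import all_boot all_order all_algebra.
From mathcomp Require Import all_classical all_reals all_analysis.

Set Implicit Arguments.
Unset Strict Implicit.
Unset Printing Implicit Defensive.

Import Order.TTheory GRing.Theory Num.Theory.
Import numFieldNormedType.Exports.

Local Open Scope ring_scope.

Record sgraph (V : finType) := SGraph {
  adj :> rel V;
  adj_sym : symmetric adj;
  adj_irr : irreflexive adj
}.

Section Graphs.
Variable V : finType.
Implicit Types (G : sgraph V) (S : {set V}).

Definition neighbours G (v : V) : {set V} := [set u | G v u]%SET.

Definition edges G : {set {set V}} :=
  [set e : {set V} | [exists u, exists v, G u v && (e == [set u; v])]]%SET.

Definition triangles G : {set {set V}} :=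
  [set t : {set V} |
    (#|t| == 3) && [forall x in t, forall y in t, (x != y) ==> G x y]]%SET.

Definition triangle_free G : Prop := triangles G = finset.set0.

Section AddEdge.
Variables (G : sgraph V) (u v : V).

(* The conjunct [x != y] keeps the relation irreflexive when u = v. *)
Definition add_edge_rel : rel V := fun x y =>
  G x y || [&& x != y, x \in [set u; v]%SET & y \in [set u; v]%SET].

Lemma add_edge_sym : symmetric add_edge_rel.
Proof.
by move=> x y; rewrite /add_edge_rel adj_sym eq_sym [in X in _ && X]andbC.
Qed.

Lemma add_edge_irr : irreflexive add_edge_rel.
Proof. by move=> x; rewrite /add_edge_rel adj_irr eqxx. Qed.

Definition add_edge : sgraph V := SGraph add_edge_sym add_edge_irr.

End AddEdge.

Definition maximal_triangle_free (R : realType) (c : R) G : Prop :=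
  triangle_free G /\
  forall u v : V, u != v -> ~~ G u v ->
    c * #|V|%:R <= #|triangles (add_edge G u v) :\: triangles G|%:R.

Definition covering_set (R : realType) (eps : R) (F : {set {set V}})
    (D : {set V}) : Prop :=
  #|D|%:R <= eps * #|V|%:R /\
  forall e, e \in F -> exists2 v, v \in e & v \in D.

(* Despite the name, G need not be a subgraph of G'. *)
Definition disturbed_subgraph (R : realType) (eps : R) (G G' : sgraph V)
    : Prop :=
  (exists D : {set V}, covering_set eps (edges G :\: edges G') D) /\
  forall v, #|neighbours G v :\: neighbours G' v|%:R <= eps * #|V|%:R.

Definition has_sparse_half (R : realType) G : Prop :=
  exists2 S : {set V}, #|S| = (#|V| %/ 2)%N &
    #|[set e in edges G | e \subset S]%SET|%:R <= #|V|%:R ^+ 2 / 50 :> R.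

End Graphs.

Section UniformSparseHalf.
Variables (R : realType) (V : finType).

Definition edge_weight (s : V -> R) (e : {set V}) : R := \prod_(v in e) s v.

Definition edges_weight (s : V -> R) (E : {set {set V}}) : R :=
  \sum_(e in E) edge_weight s e.

Definition is_half (w s : V -> R) : Prop :=
  (forall v, 0 <= s v <= w v) /\ \sum_v s v = 1 / 2.

Local Open Scope classical_set_scope.

Definition cylinders : set (set (V -> R)) :=
  \bigcup_(v in [set: V]) preimage_set_system setT (fun s => s v) measurable.

(* A distribution on halves is a Borel probability measure on R^V that is
   concentrated on the (closed) set of halves: since V is finite, the
   sigma-algebra generated by the coordinates is the Borel one. *)
Definition uniform_sparse_half (c : R) (G : sgraph V) (w : V -> R)
    (P : probability (g_sigma_algebraType cylinders) R) : Prop :=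
  [/\ P [set s | is_half w s] = 1%E,
      forall e : {set V}, e \in edges G ->
        ((c * edge_weight w e)%:E <= 'E_P[fun s => edge_weight s e])%E
    & ('E_P[fun s => edges_weight s (edges G)] <= (1 / 50)%:E)%E].

(* For #|V| = 1 this takes the value 1, outside the open interval (0, 1) of a
   weighting, so 0 < w < 1 is not imposed on w above. *)
Definition uniform_weight : V -> R := fun=> #|V|%:R^-1.

Definition has_uniform_sparse_half (c : R) (G : sgraph V) : Prop :=
  exists P : probability (g_sigma_algebraType cylinders) R, uniform_sparse_half c G uniform_weight P.

End UniformSparseHalf.

(* Main.v *)
(** Let F be the edges of G missing from G' and M the edges of G' missing from G.
    An edge of F meets at least cn edges of M, because each triangle of G' + uv
    loses an edge in the triangle-free graph G; an edge of M meets at most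
    2 eps n = c^2 n / (1 + c) edges of F, by the degree bound. Hence |F| <= c |M|.
    Since a uniform sparse half gives mean weight at least c / n^2 to each edge of
    M, and any half gives weight at most 1 / n^2 to each edge of F, the mean weight
    of G does not exceed that of G', which is at most 1/50. Any half s can be
    rounded to a set of n %/ 2 vertices spanning at most n^2 s(E(G)) edges of G, so
    the minimal number of edges spanned by such a set is at most n^2 / 50. *)

Require Import Defs.
From HB Require Import structures.
From mathcomp Require Import all_boot all_order all_algebra.
From mathcomp Require Import all_classical all_reals all_analysis.
From mathcomp Require Import ring lra.
Import Order.TTheory GRing.Theory Num.Theory.
Import numFieldNormedType.Exports.
Local Open Scope ring_scope.

(** * Double counting of intersecting pairs of added and removed edges *)

Section DoubleCounting.
Variable V : finType.
Implicit Types (G : sgraph V) (e m : {set V}).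

Lemma edgesP G e :
  reflect (exists u v, G u v /\ e = [set u; v]%SET) (e \in edges G).
Proof.
rewrite inE; apply: (iffP existsP) => [[u /existsP[v /andP[Guv /eqP ->]]]|].
  by exists u, v.
by case=> u [v [Guv ->]]; exists u; apply/existsP; exists v; rewrite Guv eqxx.
Qed.

Lemma adj_neq G u v : G u v -> u != v.
Proof. by apply: contraTneq => ->; rewrite adj_irr. Qed.

Lemma mem_edges2 G u v : ([set u; v]%SET \in edges G) = G u v.
Proof.
apply/edgesP/idP => [[x [y [Gxy E]]]|Guv]; last by exists u, v.
have xy := adj_neq _ _ _ Gxy.
have: x \in [set u; v]%SET by rewrite E set21.
have: y \in [set u; v]%SET by rewrite E set22.
rewrite !inE => /orP[] /eqP Ey /orP[] /eqP Ex; subst x y;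
  by rewrite ?eqxx // in xy *; rewrite 1?adj_sym.
Qed.

Lemma triangle_freeP G : triangle_free G ->
  forall u v w, G u v -> G u w -> G v w -> False.
Proof.
move=> tf u v w uv uw vw.
suff: [set u; v; w]%SET \in triangles G by rewrite tf inE.
rewrite inE; apply/andP; split.
  rewrite finset.setUC cardsU1 cards2 (adj_neq _ _ _ uv) !inE.
  by rewrite ![w == _]eq_sym (negPf (adj_neq _ _ _ uw)) (negPf (adj_neq _ _ _ vw)).
apply/forall_inP => x + ; rewrite !inE => xE; apply/forall_inP => y.
rewrite !inE => yE; apply/implyP.
move: xE yE => /orP[/orP[]|] /eqP -> /orP[/orP[]|] /eqP ->;
  by rewrite ?eqxx // => _; rewrite 1?adj_sym.
Qed.

(** A new triangle must use the pair uv, so it contains both ends, and its third vertex is joined to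
    them by edges of [G] itself. *)
Lemma triangles_add_edge G u v : ~~ G u v ->
  triangles (add_edge G u v) :\: triangles G \subset
    [set [set u; v; w]%SET | w in [set w | G u w && G v w]%SET].
Proof.
move=> nuv; apply/fintype.subsetP => t; rewrite finset.in_setD.
rewrite ![_ \in triangles _]inE.
case/andP => + /andP[t3 /forall_inP tadj]; rewrite t3 /= => ntri.
have uvt : (u \in t) && (v \in t).
  apply: contraR ntri => uvt; apply/forall_inP => x xt.
  apply/forall_inP => y yt; apply/implyP => xy.
  have := implyP (forall_inP (tadj _ xt) _ yt) xy.
  rewrite /= /add_edge_rel => /orP[//|/and3P[_]].
  rewrite !inE => /orP[] /eqP Ex /orP[] /eqP Ey; subst x y; move: uvt;
    by rewrite ?xt ?yt // ?eqxx // in xy *.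
have [ut vt] := andP uvt.
(* [~~ G u v] also holds for u = v; in that case no pair is added, so no triangle is new. *)
have uv : u != v.
  apply: contraNneq ntri => E; subst v.
  apply/forall_inP => x xt; apply/forall_inP => y yt; apply/implyP => xy.
  have := implyP (forall_inP (tadj _ xt) _ yt) xy.
  rewrite /= /add_edge_rel => /orP[//|/and3P[_]].
  by rewrite !inE !orbb => /eqP Ex /eqP Ey; rewrite Ex Ey eqxx in xy.
have s2 : [set u; v]%SET \subset t.
  by apply/fintype.subsetP => x; rewrite !inE => /orP[] /eqP ->.
have : #|t :\: [set u; v]%SET| == 1%N.
  by rewrite cardsD (finset.setIidPr s2) (eqP t3) cards2 uv.
case/cards1P => w tE.
have /setDP[wt] : w \in t :\: [set u; v]%SET by rewrite tE inE.
rewrite !inE negb_or => /andP[wu wv].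
apply/imsetP; exists w; last first.
  by rewrite -(setID t [set u; v]%SET) (finset.setIidPr s2) tE.
rewrite inE.
have := implyP (forall_inP (tadj _ ut) _ wt); rewrite eq_sym => /(_ wu).
have := implyP (forall_inP (tadj _ vt) _ wt); rewrite eq_sym => /(_ wv).
rewrite /= /add_edge_rel !inE (negPf wu) (negPf wv) !andbF !orbF.
by move=> -> ->.
Qed.

Definition meet_in (A : {set {set V}}) e : {set {set V}} :=
  [set m in A | (e :&: m != finset.set0)%SET]%SET.

(* For every common G'-neighbour w of the ends of uv, triangle-freeness of G
   leaves uw or vw out of G. *)
Lemma added_edge_meets_removed (R : realType) (c : R) G G' e :
  maximal_triangle_free c G' -> triangle_free G ->
  e \in edges G :\: edges G' ->
  c * #|V|%:R <= #|meet_in (edges G' :\: edges G) e|%:R.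
Proof.
move=> [tf' max'] tf /setDP[/edgesP[u [v [Guv ->]]]].
rewrite mem_edges2 => nuv; apply: le_trans (max' _ _ (adj_neq _ _ _ Guv) nuv) _.
rewrite ler_nat; apply: leq_trans (subset_leq_card (triangles_add_edge _ _ _ nuv)) _.
apply: leq_trans (leq_imset_card _ _) _.
set W := [set w | _]%SET.
pose f w := if G u w then [set v; w]%SET else [set u; w]%SET.
(* Distinct w give distinct edges: w is recovered from [f w] by deleting u and v. *)
have fD w : w \in W -> f w :\: [set u; v]%SET = [set w]%SET.
  rewrite inE => /andP[uw vw]; apply/setP => x; rewrite /f.
  case: ifP => _; rewrite !inE.
    case: (eqVneq x w) => [->|_]; last by rewrite orbF; case: (x == u); case: (x == v).
    by rewrite orbT ![w == _]eq_sym (negPf (adj_neq _ _ _ uw)) (negPf (adj_neq _ _ _ vw)).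
  case: (eqVneq x w) => [->|_]; last by rewrite orbF; case: (x == u); case: (x == v).
  by rewrite orbT ![w == _]eq_sym (negPf (adj_neq _ _ _ uw)) (negPf (adj_neq _ _ _ vw)).
have finj : {in W &, injective f}.
  by move=> w w' wW w'W ff; apply: set1_inj; rewrite -(fD w wW) ff (fD w' w'W).
rewrite -(card_in_imset finj) subset_leq_card //.
apply/fintype.subsetP => m /imsetP[w]; rewrite inE => /andP[uw vw] ->.
rewrite /f; case: ifP => Guw; rewrite !inE -!/(edges _) ?mem_edges2.
  apply/andP; split; last by apply/set0Pn; exists v; rewrite !inE eqxx orbT.
  move: (mem_edges2 G v w) (mem_edges2 G' v w); rewrite !inE => -> ->.
  by rewrite vw andbT; apply/negP => /(triangle_freeP _ tf _ _ _ Guv Guw).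
apply/andP; split; last by apply/set0Pn; exists u; rewrite !inE eqxx.
by move: (mem_edges2 G u w) (mem_edges2 G' u w); rewrite !inE => -> ->; rewrite Guw uw.
Qed.

(** An added edge that meets m passes through one of its two ends z, and leads from z into
    [neighbours G z :\: neighbours G' z]; the two ends give the factor 2. *)
Lemma removed_edge_meets_added (R : realType) (eps : R) G G' m :
  (forall v, #|neighbours G v :\: neighbours G' v|%:R <= eps * #|V|%:R) ->
  m \in edges G' ->
  #|meet_in (edges G :\: edges G') m|%:R <= 2 * eps * #|V|%:R.
Proof.
move=> deg /edgesP[x [y [_ ->]]].
pose star x := [set [set x; z]%SET | z in neighbours G x :\: neighbours G' x]%SET.
have starle z : #|star z|%:R <= eps * #|V|%:R.
  by apply: le_trans (deg z); rewrite ler_nat leq_imset_card.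
have sub : meet_in (edges G :\: edges G') [set x; y]%SET \subset star x :|: star y.
  apply/fintype.subsetP => e; rewrite inE => /andP[/setDP[/edgesP[u [v [Guv ->]]]]].
  rewrite mem_edges2 => nuv /set0Pn[z]; rewrite inE => /andP[zxy zuv].
  suff: [set u; v]%SET \in star z.
    by move: zxy; rewrite !inE => /orP[] /eqP -> ->; rewrite ?orbT.
  move: zuv; rewrite !inE => /orP[] /eqP ->; apply/imsetP.
    by exists v; rewrite // !inE Guv nuv.
  by exists u; rewrite 1?finset.setUC // !inE !(adj_sym _ v) Guv nuv.
have : #|meet_in (edges G :\: edges G') [set x; y]%SET|%:R <=
    (#|star x| + #|star y|)%:R :> R.
  rewrite ler_nat; apply: leq_trans (subset_leq_card sub) _.
  by rewrite cardsU leq_subr.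
rewrite natrD; have := starle x; have := starle y; lra.
Qed.

Lemma meet_in_double_count (A B : {set {set V}}) :
  (\sum_(e in A) #|meet_in B e| = \sum_(m in B) #|meet_in A m|)%N.
Proof.
under eq_bigr => e _ do rewrite -sum1_card.
under [RHS]eq_bigr => m _ do rewrite -sum1_card.
under eq_bigr => e _ do under eq_bigl => m do rewrite inE.
under [RHS]eq_bigr => m _ do under eq_bigl => e do rewrite inE finset.setIC.
under eq_bigr => e _ do rewrite big_mkcondr.
under [RHS]eq_bigr => m _ do rewrite big_mkcondr.
exact: exchange_big.
Qed.

Lemma added_le_removed (R : realType) (c : R) G G' :
  0 < c -> (0 < #|V|)%N -> maximal_triangle_free c G' -> triangle_free G ->
  disturbed_subgraph (c ^+ 2 / (2 * (1 + c))) G G' ->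
  #|edges G :\: edges G'|%:R <= c * #|edges G' :\: edges G|%:R.
Proof.
move=> c0 n0 max' tf [_ deg]; have n0' : 0 < #|V|%:R :> R by rewrite ltr0n.
set F := _ :\: _; set M := edges G' :\: _.
set eps := c ^+ 2 / _ in deg.
have lo : #|F|%:R * (c * #|V|%:R) <= (\sum_(e in F) #|meet_in M e|)%:R.
  rewrite mulr_natl -sumr_const natr_sum; apply: ler_sum => e eF.
  exact: added_edge_meets_removed max' tf eF.
have hi : (\sum_(m in M) #|meet_in F m|)%:R <= #|M|%:R * (2 * eps * #|V|%:R).
  rewrite mulr_natl -sumr_const natr_sum; apply: ler_sum => m /setDP[mG' _].
  exact: removed_edge_meets_added deg mG'.
rewrite meet_in_double_count in lo.
have := le_trans lo hi.
(* For this [eps], 2 eps = c * (c / (1 + c)). Cancelling c n leaves the factor c / (1 + c), which is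
   below c. *)
have -> : #|M|%:R * (2 * eps * #|V|%:R) =
    #|M|%:R * c / (1 + c) * (c * #|V|%:R).
  by rewrite /eps; field; apply/eqP; lra.
rewrite ler_pM2r ?mulr_gt0 // => /le_trans; apply.
have M0 : 0 <= #|M|%:R :> R by [].
rewrite ler_pdivrMr; nra.
Qed.

End DoubleCounting.

(** * Rounding a fractional half to a vertex set *)

Section Rounding.
Variables (R : realType) (V : finType) (G : sgraph V).
Implicit Types (x y d : V -> R).

Lemma edge_weight2 x u v : u != v -> edge_weight x [set u; v]%SET = x u * x v.
Proof. by move=> uv; rewrite /edge_weight big_setU1 ?inE // big_set1. Qed.

(** The bilinear form of the adjacency matrix: it makes the edge weight along a line a quadratic
    polynomial in the parameter. *)
Definition adj_form x y : R := \sum_a \sum_b (G a b)%:R * (x a * y b).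

(** Each edge arises from exactly two ordered pairs of adjacent vertices. *)
Lemma adj_form_edges_weight x : adj_form x x = 2 * edges_weight x (edges G).
Proof.
have -> : adj_form x x = \sum_(p : V * V | G p.1 p.2) x p.1 * x p.2.
  rewrite /adj_form pair_big /= big_mkcond [RHS]big_mkcond.
  by apply: eq_bigr => -[a b] _ /=; case: (G a b); rewrite ?mul1r ?mul0r.
rewrite (partition_big (fun p => [set p.1; p.2]%SET) (mem (edges G))) /=; last first.
  by move=> [a b] /= Gab; rewrite mem_edges2.
rewrite mulr_sumr; apply: eq_bigr => e /edgesP[u [v [Guv ->]]].
have uv := adj_neq _ _ _ _ Guv.
have vu : v != u by rewrite eq_sym.
rewrite (bigD1 (u, v)) /= ?Guv ?eqxx // (bigD1 (v, u)) /=; last first.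
  by rewrite adj_sym Guv finset.setUC eqxx xpair_eqE negb_and vu.
rewrite big1 ?addr0 => [|[a b] /=].
  by rewrite edge_weight2 // (mulrC (x v)) mulr_natl mulr2n.
case/andP => /andP[/andP[Gab /eqP E] n1] n2; exfalso.
have := adj_neq _ _ _ _ Gab.
have: a \in [set u; v]%SET by rewrite -E set21.
have: b \in [set u; v]%SET by rewrite -E set22.
rewrite !inE => /orP[] /eqP Eb /orP[] /eqP Ea; subst a b;
  by rewrite ?eqxx in n1 n2 *.
Qed.

Definition transfer (u v a : V) : R := (a == u)%:R - (a == v)%:R.

Lemma sum_transfer (F : V -> R) u v : \sum_a F a * transfer u v a = F u - F v.
Proof.
under eq_bigr => a _ do rewrite mulrBr.
rewrite sumrB (bigD1 u) //= [X in _ - X](bigD1 v) //= !eqxx !mulr1.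
by rewrite !big1 ?addr0 // => a /negPf ->; rewrite mulr0.
Qed.

(** The diagonal terms vanish by irreflexivity, which leaves -2 if u and v are adjacent and 0
    otherwise. This is the concavity behind the rounding. *)
Lemma adj_form_transfer_le0 u v : adj_form (transfer u v) (transfer u v) <= 0.
Proof.
rewrite /adj_form.
under eq_bigr => a _ do under eq_bigr => b _ do rewrite mulrA.
under eq_bigr => a _ do rewrite sum_transfer -mulrBl.
by rewrite sum_transfer !adj_irr adj_sym; case: (G v u); rewrite /=; lra.
Qed.

Lemma adj_form_line x d t :
  adj_form (fun a => x a + t * d a) (fun a => x a + t * d a) =
  adj_form x x + t * (adj_form x d + adj_form d x) + t ^+ 2 * adj_form d d.
Proof.
rewrite /adj_form mulrDr !mulr_sumr -!big_split; apply: eq_bigr => a _ /=.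
rewrite !mulr_sumr -!big_split; apply: eq_bigr => b _ /=; ring.
Qed.

Lemma transferN u v a : transfer u v a = - transfer v u a.
Proof. by rewrite /transfer opprB. Qed.

Definition fractional x : {set V} := [set v | 0 < x v < 1]%SET.

(* The weight is concave along a transfer between two coordinates, so a transfer
   in one of the two directions does not increase it. *)
Lemma fractional_transfer x : (forall v, 0 <= x v <= 1) ->
  (1 < #|fractional x|)%N ->
  exists y, [/\ forall v, 0 <= y v <= 1, \sum_v y v = \sum_v x v,
    edges_weight y (edges G) <= edges_weight x (edges G) &
    (#|fractional y| < #|fractional x|)%N].
Proof.
move=> x01 /card_gt1P[u [v [ux vx uv]]].
(* Exchanging u and v negates the linear coefficient, so it may be taken nonpositive. *)
wlog L : u v ux vx uv /
    adj_form x (transfer u v) + adj_form (transfer u v) x <= 0.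
  move=> H; set L := adj_form x (transfer u v) + adj_form (transfer u v) x.
  case: (lerP L 0) => L0; first exact: (H u v).
  apply: (H v u) => //; first by rewrite eq_sym.
  suff -> : adj_form x (transfer v u) + adj_form (transfer v u) x = - L by lra.
  rewrite /L opprD /adj_form; congr (_ + _); rewrite -sumrN; apply: eq_bigr => a _;
    rewrite -sumrN; apply: eq_bigr => b _; rewrite [transfer v u _]transferN; ring.
move: (ux) (vx); rewrite !inE => /andP[u0 u1] /andP[v0 v1].
(* The largest step that stays in [0, 1]: it brings u to 1 or v to 0, so one fractional coordinate
   disappears. *)
pose t := Num.min (1 - x u) (x v).
have t0 : 0 < t by rewrite lt_min; lra.
have tu : t <= 1 - x u by rewrite ge_min lexx.
have tv : t <= x v by rewrite ge_min lexx orbT.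
pose y a := x a + t * transfer u v a.
have vu : v != u by rewrite eq_sym.
have yu : y u = x u + t by rewrite /y /transfer eqxx (negPf uv) subr0 mulr1.
have yv : y v = x v - t by rewrite /y /transfer eqxx (negPf vu) sub0r mulrN1.
have ya a : a != u -> a != v -> y a = x a.
  by move=> /negPf au /negPf av; rewrite /y /transfer au av subrr mulr0 addr0.
exists y; split.
- move=> a; case: (eqVneq a u) => [->|au]; first by rewrite yu; lra.
  case: (eqVneq a v) => [->|av]; first by rewrite yv; lra.
  by rewrite ya.
- by rewrite big_split /= -mulr_sumr; under [X in t * X]eq_bigr => a _ do
    rewrite -[transfer _ _ _]mul1r; rewrite sum_transfer subrr mulr0 addr0.
- have E : adj_form y y = adj_form x x +
      t * (adj_form x (transfer u v) + adj_form (transfer u v) x) +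
      t ^+ 2 * adj_form (transfer u v) (transfer u v) by exact: adj_form_line.
  rewrite -(@ler_pM2l _ 2) // -!adj_form_edges_weight E -addrA gerDl -oppr_ge0 opprD addr_ge0 // oppr_ge0.
    by rewrite mulr_ge0_le0 // ltW.
  by rewrite mulr_ge0_le0 ?sqr_ge0 // adj_form_transfer_le0.
- apply: proper_card; apply/properP; split.
    apply/fintype.subsetP => a; case: (eqVneq a u) => [->//|au].
    by case: (eqVneq a v) => [->//|av]; rewrite !inE ya.
  case: (leP (1 - x u) (x v)) => h.
    exists u => //; rewrite inE yu /t min_l // addrC subrK ltxx andbF //.
  by exists v => //; rewrite inE yv /t min_r ?subrr ?ltxx // ltW.
Qed.

Lemma card_edges_in_le x (S : {set V}) : (forall v, 0 <= x v) ->
  (forall v, v \in S -> x v = 1) ->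
  #|[set e in edges G | e \subset S]%SET|%:R <= edges_weight x (edges G).
Proof.
move=> x0 x1; rewrite -sum1_card natr_sum /edges_weight.
under eq_bigl => e do rewrite inE.
rewrite big_mkcondr; apply: ler_sum => e _; case: ifP => [/fintype.subsetP eS|_].
  by rewrite /edge_weight big1 // => v /eS /x1.
by apply: prodr_ge0 => v _.
Qed.

(** Repeated transfers leave at most one fractional coordinate. S consists of the coordinates equal
    to 1, so dropping the fractional one loses less than 1 of the total. *)
Lemma rounding x : (forall v, 0 <= x v <= 1) ->
  exists S : {set V}, #|S|%:R <= \sum_v x v < #|S|%:R + 1 /\
    #|[set e in edges G | e \subset S]%SET|%:R <= edges_weight x (edges G).
Proof.
have [k] := ubnP #|fractional x|; elim: k => // k IH in x *.
move=> xk x01; case: (ltnP 1 #|fractional x|) => [/(fractional_transfer _ x01)|].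
  case=> y [y01 ysum yw yx]; have [|S [S1 S2]] := IH y _ y01.
    by apply: leq_trans yx _; rewrite -ltnS.
  by exists S; rewrite -ysum; split => //; apply: le_trans yw.
move=> fr1; exists [set v | x v == 1]%SET; split; last first.
  by apply: card_edges_in_le => v; [case/andP: (x01 v)|rewrite inE => /eqP].
set S := [set v | _]%SET.
have -> : \sum_v x v = #|S|%:R + \sum_(v in fractional x) x v.
  rewrite (bigID (mem S)) /= -sum1_card natr_sum; congr (_ + _).
    by apply: eq_bigr => v; rewrite inE => /eqP.
  rewrite big_mkcond [RHS]big_mkcond; apply: eq_bigr => v _ /=; rewrite !inE.
  case: (x01 v) => /andP[]; rewrite !le_eqVlt => /orP[/eqP <-|->].
    by rewrite ltxx; case: ifP.
  by case/orP => [/eqP ->|h]; rewrite ?eqxx ?ltxx // h lt_eqF.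
have fr : 0 <= \sum_(v in fractional x) x v < 1.
  move: fr1; rewrite leq_eqVlt ltnS leqn0 cards_eq0.
  case/orP => [/cards1P[v E]|/eqP ->]; last by rewrite big_set0 lexx ltr01.
  rewrite E big_set1; have: v \in fractional x by rewrite E set11.
  by rewrite inE => /andP[/ltW -> ->].
lra.
Qed.

Lemma half_card_gt0 (w s : V -> R) : is_half w s -> (0 < #|V|)%N.
Proof.
move=> [_ ssum]; rewrite lt0n; apply: contra_eqN ssum => /eqP V0.
rewrite big1 => [|v _]; first by apply/eqP; lra.
by move: (fintype0 v V0).
Qed.

(** Scaling by n turns s into a vector in [0, 1]^V of total n / 2 and multiplies edge weights by
    n^2; the integer part of n / 2 is the required size. *)
Lemma half_rounding (s : V -> R) : is_half (@uniform_weight R V) s ->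
  exists2 S : {set V}, #|S| = (#|V| %/ 2)%N &
    #|[set e in edges G | e \subset S]%SET|%:R / #|V|%:R ^+ 2
      <= edges_weight s (edges G).
Proof.
move=> hs; have [sw ssum] := hs.
have n0 : 0 < #|V|%:R :> R by rewrite ltr0n (half_card_gt0 _ _ hs).
have nn0 : #|V|%:R != 0 :> R by rewrite gt_eqF.
pose x v := #|V|%:R * s v.
have [|S [S1 S2]] := rounding x.
  move=> v; have /andP[s0 s1] := sw v; rewrite /x mulr_ge0 ?(ltW n0) //=.
  by rewrite mulrC -ler_pdivlMr // div1r.
exists S.
  move: S1; rewrite /x -mulr_sumr ssum.
  have -> : #|V|%:R * (1 / 2) = #|V|%:R / 2 :> R by lra.
  rewrite ler_pdivlMr // ltr_pdivrMr // => /andP[S1].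
  rewrite natr1 -!natrM !ler_nat in S1 *; rewrite ltr_nat => S3.
  by apply/eqP; rewrite eqn_leq leq_divRL // S1 -ltnS ltn_divLR // S3.
rewrite ler_pdivrMr ?exprn_gt0 //; apply: le_trans S2 _.
rewrite /edges_weight mulr_suml; apply: ler_sum => e /edgesP[u [v [Guv ->]]].
rewrite !edge_weight2 ?(adj_neq _ _ _ _ Guv) // /x.
by rewrite [leLHS](_ : _ = s u * s v * #|V|%:R ^+ 2) //; ring.
Qed.

End Rounding.

(** * Measurability of edge weights and of the set of halves *)

Section Halves.
Local Open Scope classical_set_scope.
Variables (R : realType) (V : finType).
Let T := g_sigma_algebraType (@cylinders R V).

Lemma measurable_coord (v : V) : measurable_fun [set: T] (fun s : T => s v : R).
Proof.
move=> _ B mB; rewrite setTI; apply: sub_sigma_algebra.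
by exists v => //; exists B; rewrite ?setTI.
Qed.

Lemma measurable_edge_weight (e : {set V}) :
  measurable_fun [set: T] (fun s : T => edge_weight s e : R).
Proof.
have -> : (fun s : T => edge_weight s e : R) =
    (fun s : T => \prod_(v <- enum e) s v).
  by apply/funext => s; rewrite /edge_weight big_enum.
by apply: measurable_prod => v _; exact: measurable_coord.
Qed.

Lemma measurable_halves (w : V -> R) : measurable ([set s | is_half w s] : set T).
Proof.
have -> : [set s | is_half w s] =
    (\big[setI/setT]_(v <- enum V) ((fun s : T => s v : R) @^-1` `[0, w v]))
    `&` ((fun s : T => \sum_(v <- enum V) s v : R) @^-1` [set 1 / 2]).
  rewrite -bigcap_seq; apply/seteqP; split => s /= [h1 h2]; split.
  - by move=> v _ /=; rewrite in_itv /= h1.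
  - by rewrite big_enum.
  - by move=> v; have := h1 v; rewrite /= mem_enum in_itv /=; apply.
  - by move: h2; rewrite big_enum.
apply: measurableI.
  apply: bigsetI_measurable => v _; rewrite -[X in measurable X]setTI.
  by apply: measurable_coord => //; exact: measurable_itv.
rewrite -[X in measurable X]setTI.
by apply: measurable_sum => // v; exact: measurable_coord.
Qed.

End Halves.

(** * Expectations under a distribution concentrated on halves *)

Section Expectation.
Local Open Scope classical_set_scope.
Variables (R : realType) (V : finType).
Let T := g_sigma_algebraType (@cylinders R V).
Variables (w : V -> R) (P : probability T R).
Let H : set T := [set s | is_half w s].
Hypothesis PH : P H = 1%E.

Lemma half_edge_weight (s : V -> R) (e : {set V}) : is_half w s ->
  0 <= edge_weight s e <= edge_weight w e.
Proof.
move=> [sw _]; rewrite prodr_ge0 => [|v _]; last by case/andP: (sw v).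
exact: ler_prod.
Qed.

(** The bound is asked only on halves, since edge weights may be unbounded on the whole space of
    functions. *)
Definition bounded_rv (f : T -> R) :=
  measurable_fun [set: T] f /\ exists M, forall s, H s -> `|f s| <= M.

(** The complement of [H] is null, and on [H] the function is bounded under a finite measure. *)
Lemma bounded_rv_integrable (f : T -> R) : bounded_rv f ->
  P.-integrable [set: T] (EFin \o f) /\
  'E_P[f]%E = (\int[P]_(s in H) (f s)%:E)%E.
Proof.
move=> [mf [M fM]]; have mH : measurable H := measurable_halves _ _ w.
have PnH : P (~` H) = 0%E by rewrite probability_setC // PH subee.
have TH : [set: T] `\` ~` H = H by rewrite setTD setCK.
have intf : P.-integrable [set: T] (EFin \o f).
  apply/(@negligible_integrable _ _ _ P _ (~` H)) => //.
  - exact: measurableC.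
  - exact/measurable_realfun.measurable_EFinP.
  rewrite TH; apply: measurable_bounded_integrable => //.
  - by apply: le_lt_trans (probability_le1 P mH) _; rewrite ltry.
  - exact: measurable_funS mf.
  exists M; split; first exact: num_real.
  by move=> x /ltW Mx s Hs; apply: le_trans Mx; exact: fM.
split=> //; rewrite unlock (@negligible_integral _ _ _ P _ (~` H)) ?TH //.
exact: measurableC.
Qed.

Lemma le_expectation_halves (f g : T -> R) : bounded_rv f -> bounded_rv g ->
  (forall s, H s -> f s <= g s) -> ('E_P[f] <= 'E_P[g])%E.
Proof.
move=> bf bg fg; have mH : measurable H := measurable_halves _ _ w.
have [If ->] := bounded_rv_integrable _ bf.
have [Ig ->] := bounded_rv_integrable _ bg.
apply: le_integral => //; [exact: integrableS If|exact: integrableS Ig|].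
by move=> s /set_mem Hs; rewrite lee_fin; exact: fg.
Qed.

Lemma bounded_rv_edge_weight (e : {set V}) : bounded_rv (fun s => edge_weight s e).
Proof.
split; first exact: measurable_edge_weight.
exists (edge_weight w e) => s /(half_edge_weight _ e)/andP[h0 h1].
by rewrite ger0_norm.
Qed.

Lemma bounded_rv_cst (k : R) : bounded_rv (cst k).
Proof. by split; [exact: measurable_cst|exists `|k|]. Qed.

(** Real-valued, so that the final comparison is linear arithmetic in [R]; [fine] loses nothing
    because the expectation is finite. *)
Definition mean_edge_weight (e : {set V}) : R :=
  fine 'E_P[fun s : T => edge_weight s e]%E.

Lemma mean_edge_weightE (e : {set V}) :
  'E_P[fun s : T => edge_weight s e]%E = (mean_edge_weight e)%:E.
Proof.
rewrite /mean_edge_weight fineK // unlock; apply: integrable_fin_num => //.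
exact: (bounded_rv_integrable _ (bounded_rv_edge_weight e)).1.
Qed.

Lemma mean_edge_weight_le (e : {set V}) : mean_edge_weight e <= edge_weight w e.
Proof.
rewrite -lee_fin -mean_edge_weightE -(expectation_cst P).
apply: le_expectation_halves; [exact: bounded_rv_edge_weight|exact: bounded_rv_cst|].
by move=> s /(half_edge_weight _ e)/andP[].
Qed.

Lemma expectation_edges_weight (E : {set {set V}}) :
  'E_P[fun s : T => edges_weight s E]%E = (\sum_(e in E) mean_edge_weight e)%:E.
Proof.
rewrite -sumEFin; under [RHS]eq_bigr => e _ do rewrite -mean_edge_weightE.
rewrite unlock /edges_weight.
under eq_integral => s _ do rewrite -sumEFin.
rewrite integral_sum // => e.
exact: (bounded_rv_integrable _ (bounded_rv_edge_weight e)).1.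
Qed.

Lemma bounded_rv_edges_weight (E : {set {set V}}) :
  bounded_rv (fun s => edges_weight s E).
Proof.
split.
  have -> : (fun s : T => edges_weight s E) =
      (fun s : T => \sum_(e <- enum E) edge_weight s e).
    by apply/funext => s; rewrite /edges_weight big_enum.
  by apply: measurable_sum => e; exact: measurable_edge_weight.
exists (edges_weight w E) => s Hs; rewrite ger0_norm.
  by apply: ler_sum => e _; have /andP[] := half_edge_weight _ e Hs.
by apply: sumr_ge0 => e _; have /andP[] := half_edge_weight _ e Hs.
Qed.

Lemma mean_edges_weight_ge (k : R) (E : {set {set V}}) :
  (forall s, is_half w s -> k <= edges_weight s E) ->
  k <= \sum_(e in E) mean_edge_weight e.
Proof.
move=> kE; rewrite -lee_fin -expectation_edges_weight -(expectation_cst P).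
by apply: le_expectation_halves => //;
  [exact: bounded_rv_cst|exact: bounded_rv_edges_weight].
Qed.

End Expectation.

(** * Comparison of the mean weights of the two graphs *)

Theorem theorem4p3 (R : realType) (c : R) (V : finType) (G G' : sgraph V) :
  0 < c < 1 ->
  maximal_triangle_free c G' ->
  triangle_free G ->
  disturbed_subgraph (c ^+ 2 / (2 * (1 + c))) G G' ->
  has_uniform_sparse_half c G' ->
  has_sparse_half R G.
Proof.
move=> /andP[c0 _] max' tf dist [P [PH lo hi]].
(* An event of probability 1 is nonempty. One half gives n > 0 and, by rounding, a first candidate
   for the minimisation below. *)
have [s Hs] : exists s, is_half (@uniform_weight R V) s.
  apply: contrapT => nH; move: PH.
  have -> : [set s | is_half (@uniform_weight R V) s]%classic = set0.
    by apply/seteqP; split => // s Hs; apply: nH; exists s.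
  by rewrite measure0 => /eqP; rewrite eqe eq_sym oner_eq0.
have n0 := half_card_gt0 _ _ _ _ Hs.
have [S0 S0n _] := half_rounding _ _ G _ Hs.
pose cnt (S : {set V}) := #|[set e in edges G | e \subset S]%SET|.
(* The minimal count is one constant that bounds the scaled weight of every half from below,
   whichever set that half rounds to. *)
case: (@arg_minnP _ S0 (fun S => #|S| == (#|V| %/ 2)%N) cnt); first exact/eqP.
move=> S /eqP Sn Smin; exists S => //; rewrite -/(cnt S).
have n2 : 0 < #|V|%:R ^+ 2 :> R by rewrite exprn_gt0 // ltr0n.
have w2 H e : e \in edges H ->
    edge_weight (@uniform_weight R V) e = (#|V|%:R ^+ 2)^-1.
  case/edgesP => u [v [uv ->]]; rewrite edge_weight2 ?(adj_neq _ _ _ _ uv) //.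
  by rewrite /uniform_weight -invfM.
pose m := mean_edge_weight _ _ P.
have low : (cnt S)%:R / #|V|%:R ^+ 2 <= \sum_(e in edges G) m e.
  apply: mean_edges_weight_ge PH _ _ _ => t /(half_rounding _ _ G)[S' S'n S'w].
  apply: le_trans S'w; rewrite ler_pM2r ?invr_gt0 // ler_nat.
  by apply: Smin; apply/eqP.
have high : \sum_(e in edges G') m e <= 1 / 50.
  by rewrite -lee_fin -(expectation_edges_weight _ _ _ _ PH).
have addF : \sum_(e in edges G :\: edges G') m e <=
    #|edges G :\: edges G'|%:R / #|V|%:R ^+ 2.
  rewrite mulr_natl -sumr_const; apply: ler_sum => e /setDP[eG _].
  by rewrite -(w2 G e eG); exact: mean_edge_weight_le PH _.
have remM : c * #|edges G' :\: edges G|%:R / #|V|%:R ^+ 2 <=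
    \sum_(e in edges G' :\: edges G) m e.
  rewrite mulrAC mulr_natr -sumr_const; apply: ler_sum => e /setDP[eG' _].
  by rewrite -(w2 G' e eG') -lee_fin -(mean_edge_weightE _ _ _ _ PH); exact: lo.
have FM : #|edges G :\: edges G'|%:R / #|V|%:R ^+ 2 <=
    c * #|edges G' :\: edges G|%:R / #|V|%:R ^+ 2.
  by rewrite ler_pM2r ?invr_gt0 //; exact: added_le_removed.
rewrite -ler_pdivrMl // mulrC; apply: le_trans low _.
(* Both sums split off the common edges. What remains is mean(F) <= |F| / n^2 <= c |M| / n^2 <=
   mean(M). *)
rewrite (big_setID (edges G')) /=.
rewrite (big_setID (edges G)) /= finset.setIC in high.
lra.
Qed.
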